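(* The universal, neighboring-order, and all-order inequalities do not characterize minor-order exponent profiles. That is, there exist an integer $n\ge2$ and a vector of positive integers $(f_1,\dots,f_n)$ with $f_n=1$ satisfying $$f_k\le\max\{k,n-k\}\quad(1\le k<n),$$ $$|f_{k+1}-f_k|\le1\quad(1\le k\le n-2),$$ $$f_j\le\left\lceil\max\left\{\frac{j}{k},\frac{n-j}{n-k}\right\}\right\rceil f_k\quad(1\le j,k\le n-1),$$ such that $(f_1,\dots,f_n)$ is not the minor-order exponent profile of any $n\times n$ oscillatory matrix.
   Context: All matrices are real. A matrix is totally nonnegative (TN) if all its minors are $\ge0$ and totally positive (TP) if all its minors are $>0$; a square TN matrix is oscillatory if some positive power of it is TP. For an $n\times n$ oscillatory matrix $A$ and $1\le k\le n$, $e_k(A)=\min\{m\ge1:\text{all minors of order }k\text{ of }A^m\text{ are positive}\}$; the minor-order exponent profile of $A$ is $(e_1(A),\dots,e_n(A))$. Every such profile satisfies $e_n(A)=1$ and the three displayed families of inequalities. *)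

(* Defs.v *)
From mathcomp Require Import all_boot all_order all_algebra.
From mathcomp Require Import reals.

Set Implicit Arguments.
Unset Strict Implicit.
Unset Printing Implicit Defensive.

Import Order.TTheory GRing.Theory Num.Theory.
Local Open Scope ring_scope.

Definition increasing (k n : nat) (s : 'I_k -> 'I_n) : Prop :=
  forall i j : 'I_k, (i < j)%N -> (s i < s j)%N.

(* The minors of order k of A are the determinants \det (mxsub r c A) with r, c
   strictly increasing; for k = 0 the only one is 1. *)
Definition minors_nonneg (R : realType) (m n k : nat) (A : 'M[R]_(m, n)) : Prop :=
  forall (r : 'I_k -> 'I_m) (c : 'I_k -> 'I_n),
    increasing r -> increasing c -> 0 <= \det (mxsub r c A).

Definition minors_pos (R : realType) (m n k : nat) (A : 'M[R]_(m, n)) : Prop :=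
  forall (r : 'I_k -> 'I_m) (c : 'I_k -> 'I_n),
    increasing r -> increasing c -> 0 < \det (mxsub r c A).

Definition totally_nonneg (R : realType) (m n : nat) (A : 'M[R]_(m, n)) : Prop :=
  forall k : nat, minors_nonneg k A.

Definition totally_pos (R : realType) (m n : nat) (A : 'M[R]_(m, n)) : Prop :=
  forall k : nat, minors_pos k A.

Definition oscillatory (R : realType) (n : nat) (A : 'M[R]_n) : Prop :=
  totally_nonneg A /\ exists2 p : nat, (0 < p)%N & totally_pos (A ^+ p).

(* e_k(A) = e, as a relation: the minimum need not exist for general A. *)
Definition minor_exponent (R : realType) (n k : nat) (A : 'M[R]_n) (e : nat) :
    Prop :=
  [/\ (1 <= e)%N, minors_pos k (A ^+ e) &
      forall m : nat, (1 <= m)%N -> minors_pos k (A ^+ m) -> (e <= m)%N].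

(* The vector (f_1, ..., f_n) is given by f : nat -> nat, whose values outside
   1, ..., n are irrelevant. *)
Definition minor_exponent_profile (R : realType) (n : nat) (A : 'M[R]_n)
    (f : nat -> nat) : Prop :=
  forall k : nat, (1 <= k <= n)%N -> minor_exponent k A (f k).

(* Main.v *)
Require Import Defs.
From mathcomp Require Import all_boot all_order all_algebra.
From mathcomp Require Import reals.
From mathcomp Require Import zify.
Import Order.TTheory GRing.Theory Num.Theory.
Local Open Scope ring_scope.
Set Implicit Arguments.
Unset Strict Implicit.
Unset Printing Implicit Defensive.

(** The vector (6, 5, 4, 3, 3, 2, 2, 1, 1), with n = 9, satisfies all three
    families of inequalities but is not a profile: for a 9 x 9 oscillatory
    matrix, e_6 = 2 forces e_1 <= 5, whereas the inequality for j = 1, k = 6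
    only gives e_1 <= ceil(8/3) * 2 = 6.

    Read A as the weights of a walk on {0, ..., 8}, a positive entry A i j
    being a possible step from i to j.  The 2 x 2 minors make a zero of A above
    the diagonal spread to the whole block to its upper right
    (upper_block0), so a step i -> j with i < j makes every upward step inside
    [i, j] possible as well.  Since a power of A is positive, A is irreducible and
    hence all steps i -> i and i -> i+1 exist.

    The steps of length two come from e_6 = 2 (second_superdiag_gt0).  If
    A i (i+2) = 0 with 1 <= i <= 5, then A vanishes on rows <= i, columns
    >= i+2, so on that block A^2 factors through the single index i+1 and has
    rank at most 1.  The block has i+1 rows and 7-i columns, 8 in all, and it
    sits inside the 6 x 6 submatrix of A^2 on the first six rows and the last
    six columns.  A block of rank <= 1 with 8 = 6 + 2 rows and columns in total
    makes a 6 x 6 determinant vanish, contrary to e_6 = 2.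

    So 0 -> 1 -> 3 -> 5 -> 7 -> 8 is a walk of length five from corner to
    corner; restricting it to [i, j] shows that A^5 is positive on and
    above the diagonal (upper_exp_gt0), and the same argument for the transpose of A
    settles the entries below.  The all-order inequality loses here because
    it only uses that two consecutive steps can advance by three, while almost
    every single step can already advance by two. *)

(** * Minors of order one and two, and transposition *)

Lemma pair_increasing {n : nat} (p q : 'I_n) :
  (p < q)%N -> increasing (fun x : 'I_2 => if x == 0 then p else q).
Proof.
move=> pq x y; case: x => -[|[|//]] ?; case: y => -[|[|//]] ? //=.
Qed.

Lemma minor2_le {R : realType} {n : nat} (A : 'M[R]_n) (p p' q q' : 'I_n) :
  minors_nonneg 2 A -> (p < p')%N -> (q < q')%N ->
  A p q' * A p' q <= A p q * A p' q'.
Proof.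
move=> A2 pp qq; have := A2 _ _ (pair_increasing pp) (pair_increasing qq).
rewrite (expand_det_row _ ord0) !big_ord_recl big_ord0 /cofactor !det_mx11.
by rewrite !mxE /= expr0 expr1 mul1r mulN1r mulrN addr0 subr_ge0.
Qed.

Lemma minors_nonneg1 {R : realType} {n : nat} (A : 'M[R]_n) :
  minors_nonneg 1 A -> forall i j, 0 <= A i j.
Proof.
move=> A1 i j; have := A1 (fun=> i) (fun=> j).
rewrite det_mx11 mxE; apply; by move=> x y; rewrite !ord1.
Qed.

Lemma minors_pos1 {R : realType} {n : nat} (A : 'M[R]_n) :
  minors_pos 1 A <-> (forall i j, 0 < A i j).
Proof.
split=> [A1 i j|A1 r c _ _]; last by rewrite det_mx11 mxE.
have := A1 (fun=> i) (fun=> j).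
rewrite det_mx11 mxE; apply; by move=> x y; rewrite !ord1.
Qed.

Lemma minors_nonneg_tr {R : realType} {n : nat} (k : nat) (A : 'M[R]_n) :
  minors_nonneg k A -> minors_nonneg k A^T.
Proof. by move=> Ak r c rI cI; rewrite -det_tr trmx_mxsub trmxK; apply: Ak. Qed.

Lemma minors_pos_tr {R : realType} {n : nat} (k : nat) (A : 'M[R]_n) :
  minors_pos k A -> minors_pos k A^T.
Proof. by move=> Ak r c rI cI; rewrite -det_tr trmx_mxsub trmxK; apply: Ak. Qed.

Lemma trmx_exp {R : realType} {n : nat} (A : 'M[R]_n) (m : nat) :
  (A ^+ m)^T = A^T ^+ m.
Proof.
elim: m => [|m IH]; first by rewrite !expr0 trmx1.
by rewrite exprS exprSr -IH trmx_mul.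
Qed.

(** * Irreducibility *)

Definition irreducible_mx {R : realType} {n : nat} (A : 'M[R]_n) : Prop :=
  forall (S : pred 'I_n) (p q : 'I_n), S p -> ~~ S q ->
    exists i j, [/\ S i, ~~ S j & A i j != 0].

Lemma closed_expmx0 {R : realType} {n : nat} (A : 'M[R]_n) (S : pred 'I_n) :
  (forall p q, S p -> ~~ S q -> A p q = 0) ->
  forall (m : nat) (p q : 'I_n), S p -> ~~ S q -> (A ^+ m) p q = 0.
Proof.
move=> AS; elim=> [|m IH] p q Sp Sq.
  rewrite expr0 mxE; case: eqP => // pq; by rewrite -pq Sp in Sq.
rewrite exprS mxE big1 // => l _.
by have [Sl|Sl] := boolP (S l); [rewrite IH ?mulr0|rewrite AS ?mul0r].
Qed.

Lemma irreducible_exp {R : realType} {n : nat} (A : 'M[R]_n) (m : nat) :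
  (forall i j, 0 < (A ^+ m) i j) -> irreducible_mx A.
Proof.
move=> Am S p q Sp Sq.
have [/existsP[i /existsP[j /and3P[]]]|none] :=
  boolP [exists i, [exists j, [&& S i, ~~ S j & A i j != 0]]].
  by exists i, j.
have := Am p q; rewrite (@closed_expmx0 _ _ _ S) ?ltxx // => i j Si Sj.
apply/eqP/negPn/negP => Aij; case/negP: none.
by apply/existsP; exists i; apply/existsP; exists j; rewrite Si Sj.
Qed.

Lemma irreducible_tr {R : realType} {n : nat} (A : 'M[R]_n) :
  irreducible_mx A -> irreducible_mx A^T.
Proof.
move=> Airr S p q Sp Sq.
have [||i [j [Si /negPn Sj Aij]]] := Airr (predC S) q p.
- exact: Sq.
- by rewrite /= Sp.
by exists j, i; rewrite mxE.
Qed.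

(** * Zero patterns under the sign condition on minors of order two *)

Section ZeroPattern.
Context {R : realType} {n : nat} (A : 'M[R]_n).
Hypotheses (A1 : minors_nonneg 1 A) (A2 : minors_nonneg 2 A).

Let A_ge0 i j : 0 <= A i j. Proof. exact: minors_nonneg1. Qed.

(** The products of the two diagonals of a 2 x 2 submatrix are ordered, so a
    zero on the main diagonal forces one on the antidiagonal. *)
Lemma uncross0 (p p' q q' : 'I_n) : (p < p')%N -> (q < q')%N ->
  A p q = 0 \/ A p' q' = 0 -> A p q' = 0 \/ A p' q = 0.
Proof.
move=> pp qq Apq; suff /eqP : A p q' * A p' q = 0.
  by rewrite mulf_eq0 => /orP[]/eqP; [left|right].
apply/eqP; rewrite eq_le mulr_ge0 // andbT.
rewrite (le_trans (minor2_le A2 pp qq)) //.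
by case: Apq => ->; rewrite ?mul0r ?mulr0.
Qed.

Hypothesis Airr : irreducible_mx A.

Lemma not_closed (S : pred 'I_n) (p q : 'I_n) : S p -> ~~ S q ->
  ~ (forall i j, S i -> ~~ S j -> A i j = 0).
Proof.
move=> Sp Sq clS; have [i [j [Si Sj]]] := Airr Sp Sq.
by rewrite clS ?eqxx.
Qed.

(** If A i i = 0, uncrossing makes the part of row i left of the diagonal or
    the part of column i above it vanish, and likewise on the other side.  In
    each of the four cases some set of indices becomes closed under the steps
    of A, against irreducibility.  The index j is there only to exclude the
    1 x 1 zero matrix. *)
Lemma diag_gt0 (i j : 'I_n) : i != j -> 0 < A i i.
Proof.
move=> ij; rewrite lt0r A_ge0 andbT; apply/eqP => Aii.
have L : (forall q : 'I_n, (q < i)%N -> A i q = 0) \/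
         (forall p : 'I_n, (p < i)%N -> A p i = 0).
  have [/forallP L|/forallPn[q]] :=
    boolP [forall q : 'I_n, (q < i)%N ==> (A i q == 0)].
    by left=> q qi; apply/eqP/(implyP (L q)).
  rewrite negb_imply => /andP[qi /eqP Aiq]; right=> p pi.
  by have [|//|] := @uncross0 p i q i pi qi; [right|].
have U : (forall q : 'I_n, (i < q)%N -> A i q = 0) \/
         (forall p : 'I_n, (i < p)%N -> A p i = 0).
  have [/forallP U|/forallPn[q]] :=
    boolP [forall q : 'I_n, (i < q)%N ==> (A i q == 0)].
    by left=> q qi; apply/eqP/(implyP (U q)).
  rewrite negb_imply => /andP[qi /eqP Aiq]; right=> p pi.
  by have [|//|] := @uncross0 i p i q pi qi; [left|].
have row0 : ~ forall q, A i q = 0.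
  move=> Ai0; apply: (@not_closed (pred1 i) i j); rewrite /= ?eqxx 1?eq_sym //.
  by move=> p q /eqP ->.
have col0 : ~ forall p, A p i = 0.
  move=> Ai0; apply: (@not_closed (predC1 i) j i); rewrite /= ?eqxx 1?eq_sym //.
  by move=> p q _ /negPn/eqP ->.
case: L U => L [] U.
- apply: row0 => q; case: (ltngtP q i) => [/L //|/U //|/val_inj -> //].
- (* Uncrossing with a nonzero entry of row i right of the diagonal clears all
     rows > i in the columns <= i, so the indices > i are closed. *)
  have [q] : exists q, A i q != 0.
    have [/existsP//|/existsPn Ai0] := boolP [exists q, A i q != 0].
    by case: row0 => q; apply/eqP/negPn.
  move=> Aiq; have iq : (i < q)%N.
    by case: (ltngtP q i) Aiq => [/L ->|//|/val_inj ->]; rewrite ?Aii eqxx.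
  apply: (@not_closed (fun p : 'I_n => i < p)%N q i) => //; first by rewrite ltnn.
  move=> p q' ip; rewrite -leqNgt leq_eqVlt => /predU1P[/val_inj -> |q'i].
    exact: U.
  have [|Aiq0|//] := @uncross0 i p q' q ip (ltn_trans q'i iq).
    by left; apply: L.
  by rewrite Aiq0 eqxx in Aiq.
- have [q] : exists q, A i q != 0.
    have [/existsP//|/existsPn Ai0] := boolP [exists q, A i q != 0].
    by case: row0 => q; apply/eqP/negPn.
  move=> Aiq; have iq : (q < i)%N.
    by case: (ltngtP q i) Aiq => [//|/U ->|/val_inj ->]; rewrite ?Aii eqxx.
  apply: (@not_closed (fun p : 'I_n => p < i)%N q i) => //; first by rewrite ltnn.
  move=> p q' ip; rewrite -leqNgt leq_eqVlt => /predU1P[/val_inj <- |q'i].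
    exact: L.
  have [|//|Aiq0] := @uncross0 p i q q' ip (ltn_trans iq q'i).
    by right; apply: U.
  by rewrite Aiq0 eqxx in Aiq.
- apply: col0 => q; case: (ltngtP q i) => [/L //|/U //|/val_inj -> //].
Qed.

(** Uncross first with A i i, which moves the zero up column j, then with
    A j j, which moves it right along row p. *)
Lemma upper_block0 (i j p q : 'I_n) : (i < j)%N -> A i j = 0 ->
  (p <= i)%N -> (j <= q)%N -> A p q = 0.
Proof.
move=> ij Aij pi jq.
have iNj : i != j by rewrite neq_ltn ij.
have [Aii Ajj] : A i i != 0 /\ A j j != 0.
  by split; apply/lt0r_neq0; [apply: (diag_gt0 iNj)
                             |apply: (@diag_gt0 j i); rewrite eq_sym].
have Apj : A p j = 0.
  move: pi; rewrite leq_eqVlt => /predU1P[/val_inj -> //|pi].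
  have [|//|/eqP] := @uncross0 p i i j pi ij; first by right.
  by rewrite (negPf Aii).
move: jq; rewrite leq_eqVlt => /predU1P[/val_inj <- //|jq].
have [|//|/eqP] := @uncross0 p j j q (leq_ltn_trans pi ij) jq; first by left.
by rewrite (negPf Ajj).
Qed.

(** A zero here would spread to all entries from indices <= i to indices > i,
    leaving the former closed. *)
Lemma superdiag_gt0 (i j : 'I_n) : j = i.+1 :> nat -> 0 < A i j.
Proof.
move=> ij; rewrite lt0r A_ge0 andbT; apply/eqP => Aij.
have lt_ij : (i < j)%N by rewrite ij.
apply: (@not_closed (fun p : 'I_n => p <= i)%N i j) => //.
  by rewrite -ltnNge.
move=> p q pi; rewrite -ltnNge => iq.
by apply: upper_block0 lt_ij Aij pi _; rewrite ij.
Qed.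

(** An increasing walk whose ends enclose i and j can be clamped to [i, j]: each
    clamped step either stays put or lies inside the original one, so it is
    allowed by diag_gt0 or upper_block0.  Thus one walk between the corners controls all entries on
    and above the diagonal. *)
Lemma upper_exp_gt0 (m : nat) (w : nat -> 'I_n) (i j : 'I_n) :
  (forall t, (t < m)%N -> (w t < w t.+1)%N /\ 0 < A (w t) (w t.+1)) ->
  (w 0 <= i)%N -> (i <= j)%N -> (j <= w m)%N -> 0 < (A ^+ m) i j.
Proof.
move=> w_walk w0i ij jwm.
have clamp_lt t : (minn j (maxn i (w t)) < n)%N.
  by rewrite gtn_min ltn_ord.
pose x t := Ordinal (clamp_lt t).
have x0 : x 0 = i.
  by apply: val_inj; rewrite /= (maxn_idPl w0i); apply/minn_idPr.
have xm : x m = j.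
  by apply: val_inj; apply/minn_idPl; rewrite leq_max jwm orbT.
have x_step t : (t < m)%N -> 0 < A (x t) (x t.+1).
  move=> tm; have [wt Awt] := w_walk t tm.
  have [x_eq|x_neq] := eqVneq (x t) (x t.+1).
    rewrite -x_eq; have wt_neq : w t != w t.+1 by rewrite neq_ltn wt.
    case: (eqVneq (w t) (x t)) => [<-|]; first exact: diag_gt0 wt_neq.
    by rewrite eq_sym; apply: diag_gt0.
  have x_lt : (x t < x t.+1)%N.
    by rewrite ltn_neqAle (x_neq : (x t != x t.+1 :> nat)) /=; lia.
  rewrite lt0r A_ge0 andbT; apply: contra_neq (lt0r_neq0 Awt) => Ax.
  by apply: (upper_block0 x_lt Ax); move: x_lt => /=; lia.
have exp_ge0 t p q : 0 <= (A ^+ t) p q.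
  elim: t p q => [|t IH] p q; first by rewrite expr0 mxE; case: eqP.
  by rewrite exprS mxE sumr_ge0 // => l _; rewrite mulr_ge0.
suff H t : (t <= m)%N -> 0 < (A ^+ t) i (x t) by rewrite -xm H.
elim: t => [_|t IH tm]; first by rewrite x0 expr0 mxE eqxx.
rewrite exprSr mxE (bigD1 (x t)) //= ltr_wpDr //.
  by rewrite sumr_ge0 // => l _; rewrite mulr_ge0.
by rewrite mulr_gt0 ?x_step // IH // ltnW.
Qed.
End ZeroPattern.

(** * Steps of length two *)

Lemma underdetermined (F : fieldType) (a b : nat) (D : 'M[F]_(a, b)) :
  (b < a)%N -> exists2 v : 'rV[F]_a, v != 0 & v *m D = 0.
Proof.
move=> ba; have : kermx D != 0.
  by rewrite kermx_eq0 -row_leq_rank -ltnNge (leq_ltn_trans (rank_leq_col D)).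
by case/rowV0Pn=> v /sub_kermxP vD v0; exists v.
Qed.

(** If A i (i+2) = 0, the first i+1 rows of the submatrix of A^2 on the first
    n-3 rows and the last n-3 columns are dependent, where n = m+4.  Consider
    row vectors v supported on these rows.  Their products with the columns
    <= i+1 of the submatrix, which are columns 3, ..., i+1 of A^2, give i-1
    linear forms.  On the remaining columns v A^2 only depends on (v A) at
    i+1, because v A is supported on the indices <= i+1 and the rows <= i of A
    vanish there.  So i linear conditions on i+1 coordinates suffice for v to
    kill the submatrix.  The bounds on i ensure that these rows and columns do
    lie inside it. *)
Lemma second_superdiag_gt0 (R : realType) (m : nat) (A : 'M[R]_m.+4)
    (i j : 'I_m.+4) :
  minors_nonneg 1 A -> minors_nonneg 2 A -> irreducible_mx A ->
  minors_pos m.+1 (A ^+ 2) ->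
  (0 < i <= m)%N -> j = i.+2 :> nat -> 0 < A i j.
Proof.
move=> A1 A2 Airr posA /andP[i_gt0 le_im] ji.
rewrite lt0r minors_nonneg1 // andbT; apply/eqP => Aij.
have block0 (p q : 'I_m.+4) : (p <= i)%N -> (i.+2 <= q)%N -> A p q = 0.
  by move=> pi iq; apply: (upper_block0 A1 A2 Airr _ Aij pi); rewrite ji.
pose r (p : 'I_m.+1) : 'I_m.+4 := widen_ord (leq_addl 3 m.+1) p.
pose c (q : 'I_m.+1) : 'I_m.+4 := rshift 3 q.
pose h : 'I_m.+4 := inord i.+1.
have hE : h = i.+1 :> nat by rewrite inordK //; lia.
(* The columns of D list the conditions on v: i-1 columns of A^2, the column
   i+1 of A, and the m-i coordinates outside the support. *)
pose D : 'M[R]_(m.+1, m) := \matrix_(p, b)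
  if (b < i.-1)%N then (A ^+ 2) (r p) (c (widen_ord (leqnSn m) b))
  else if (b == i.-1 :> nat) then A (r p) h else (p == b.+1 :> nat)%:R.
have [v v_neq0 vD] := underdetermined D (ltnSn m).
have vD0 b : \sum_p v 0 p * D p b = 0.
  by have /rowP/(_ b) := vD; rewrite !mxE.
have v_supp (p : 'I_m.+1) : (i < p)%N -> v 0 p = 0.
  move=> ip; have lt_pm : (p.-1 < m)%N by have := ltn_ord p; lia.
  have := vD0 (Ordinal lt_pm).
  rewrite (bigD1 p) //= big1 ?addr0 => [|q qp]; rewrite mxE /=.
    by rewrite ifN ?ifN ?prednK ?eqxx ?mulr1 //; lia.
  rewrite ifN ?ifN ?prednK; try lia.
  by rewrite (negPf (qp : (q != p :> nat))) mulr0.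
have v_h : \sum_p v 0 p * A (r p) h = 0.
  have lt_im : (i.-1 < m)%N by lia.
  rewrite -[RHS](vD0 (Ordinal lt_im)); apply: eq_bigr => p _.
  by rewrite mxE /= ltnn eqxx.
have vA2 q : \sum_p v 0 p * (A ^+ 2) (r p) (c q) = 0.
  have [q_small|q_large] := ltnP q i.-1.
    have lt_qm : (q < m)%N by lia.
    rewrite -[RHS](vD0 (Ordinal lt_qm)); apply: eq_bigr => p _.
    rewrite [D _ _]mxE /= q_small; congr (_ * (A ^+ 2) _ (c _)); exact: val_inj.
  under eq_bigr => p _ do rewrite expr2 mxE mulr_sumr.
  rewrite exchange_big big1 //= => l _.
  under eq_bigr => p _ do rewrite mulrA.
  rewrite -mulr_suml; case: (ltngtP l i.+1) => [l_small|l_large|l_h].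
  - by rewrite block0 ?mulr0 //=; lia.
  - rewrite big1 ?mul0r // => p _; have [ip|pi] := ltnP i p.
      by rewrite v_supp ?mul0r.
    by rewrite block0 ?mulr0.
  - have -> : l = h by apply: ord_inj; rewrite hE.
    by rewrite v_h mul0r.
suff det0 : \det (mxsub r c (A ^+ 2)) = 0.
  have rI : increasing r by [].
  have cI : increasing c by move=> x y xy; rewrite /= ltn_add2l.
  by have := posA r c rI cI; rewrite det0 ltxx.
apply/eqP/det0P; exists v => //; apply/rowP => q; rewrite !mxE -[RHS](vA2 q).
by apply: eq_bigr => p _; rewrite mxE.
Qed.

(** * A bound on the first exponent for n = 9 *)

Lemma exp5_upper_gt0 (R : realType) (A : 'M[R]_9) :
  minors_nonneg 1 A -> minors_nonneg 2 A -> irreducible_mx A ->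
  minors_pos 6 (A ^+ 2) ->
  forall i j : 'I_9, (i <= j)%N -> 0 < (A ^+ 5) i j.
Proof.
move=> A1 A2 Airr posA i j ij.
pose w (t : nat) : 'I_9 := inord (nth 8 [:: 0; 1; 3; 5; 7]%N t).
apply: (@upper_exp_gt0 _ _ A A1 A2 Airr 5 w); rewrite ?inordK //; last first.
  by rewrite -ltnS.
case=> [|[|[|[|[|//]]]]] _; rewrite !inordK //; split=> //.
- by apply: superdiag_gt0; rewrite ?inordK.
- by apply: second_superdiag_gt0; rewrite ?inordK.
- by apply: second_superdiag_gt0; rewrite ?inordK.
- by apply: second_superdiag_gt0; rewrite ?inordK.
- by apply: superdiag_gt0; rewrite ?inordK.
Qed.

Lemma minors_pos1_exp5 (R : realType) (A : 'M[R]_9) :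
  oscillatory A -> minors_pos 6 (A ^+ 2) -> minors_pos 1 (A ^+ 5).
Proof.
move=> [Ann [p _ Ap]] posA.
have Airr : irreducible_mx A by apply/irreducible_exp/minors_pos1/(Ap 1).
apply/minors_pos1 => i j; case: (leqP i j) => [ij|/ltnW ji].
  exact: exp5_upper_gt0.
have -> : (A ^+ 5) i j = (A^T ^+ 5) j i by rewrite -trmx_exp [RHS]mxE.
apply: exp5_upper_gt0 => //; try exact: minors_nonneg_tr.
  exact: irreducible_tr.
by rewrite -trmx_exp; apply: minors_pos_tr.
Qed.

(** * The counterexample *)

(** Reduces the all-order inequality to natural numbers: c + 1 is a lower bound
    for the ceiling as soon as c is below one of the two ratios. *)
Lemma le_ceil_max_ratio (n j k a b c : nat) :
  (0 < k < n)%N -> (c * k < j)%N || (c * (n - k) < n - j)%N ->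
  (a <= c.+1 * b)%N ->
  a%:Z <= Num.ceil (Num.max (j%:R / k%:R : rat) ((n - j)%:R / (n - k)%:R))
          * b%:Z.
Proof.
move=> /andP[k_gt0 kn] c_lt ab.
apply: (@le_trans _ _ (c.+1%:Z * b%:Z)); first by rewrite -PoszM lez_nat.
rewrite ler_wpM2r // -[c.+1]addn1 PoszD lezD1 ceil_gt_int.
rewrite lt_max !ltr_pdivlMr ?ltr0n ?subn_gt0 //.
by rewrite -!natrM !ltr_nat.
Qed.

Theorem corollary8p4 (R : realType) :
  exists (n : nat) (f : nat -> nat),
    (2 <= n)%N /\
    (forall k : nat, (1 <= k <= n)%N -> (0 < f k)%N) /\
    f n = 1%N /\
    (forall k : nat, (1 <= k < n)%N -> (f k <= maxn k (n - k))%N) /\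
    (forall k : nat, (1 <= k <= n - 2)%N ->
       `|(f k.+1)%:Z - (f k)%:Z| <= 1) /\
    (forall j k : nat, (1 <= j <= n - 1)%N -> (1 <= k <= n - 1)%N ->
       (f j)%:Z <=
         Num.ceil (Num.max (j%:R / k%:R : rat) ((n - j)%:R / (n - k)%:R))
           * (f k)%:Z) /\
    ~ (exists A : 'M[R]_n, oscillatory A /\ minor_exponent_profile A f).
Proof.
(* The list starts with f 1, hence the predecessor. *)
pose f k := nth 1%N [:: 6; 5; 4; 3; 3; 2; 2; 1; 1]%N k.-1.
exists 9%N, f; split=> //; split.
  by do 10 case=> //.
split=> //; split; first by do 10 case=> //.
split; first by do 8 case=> //.
split.
  (* c j k + 1 is the least multiplier of f k that reaches f j. *)
  pose c j k := ((f j).-1 %/ f k)%N.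
  have H : all (fun j => all (fun k =>
      ((c j k * k < j) || (c j k * (9 - k) < 9 - j))
        && (f j <= (c j k).+1 * f k))%N (iota 1 8)) (iota 1 8) by [].
  move=> j k jP kP; have mem_iota8 i : (1 <= i <= 9 - 1)%N -> i \in iota 1 8.
    by rewrite mem_iota.
  have /andP[cP fP] := allP (allP H j (mem_iota8 j jP)) k (mem_iota8 k kP).
  by apply: le_ceil_max_ratio cP fP.
move=> [A [Aosc Aprof]].
have [_ posA _] := Aprof 6%N isT.
have [_ _ /(_ 5%N isT)] := Aprof 1%N isT.
by move=> /(_ (minors_pos1_exp5 Aosc posA)).
Qed.
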